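(* Let $G(z)=\sum_{p=0}^{d}z^pA_p+\sum_{j=1}^k w_j(z)E_j$ be an $n\times n$ skew-symmetric rational matrix polynomial (i.e. $A_p^T=-A_p$ for $p=0,\ldots,d$ and $E_j^T=-E_j$ for $j=1,\ldots,k$), and let $\lambda\in\mathbb{C}$ be such that $\lambda$ is not a pole of $G(z)$ and $w_j(\lambda)\neq 0$ for $j=1,\ldots,k$. Suppose that $M:=(G(\lambda))^{-1}$ exists. Set $$\Lambda:=[1,\lambda,\ldots,\lambda^d,w_1(\lambda),\ldots,w_k(\lambda)]\in\mathbb{C}^{1\times(d+k+1)},\qquad J:=\Lambda^*\Lambda\otimes M^*M,$$ and, for $p=0,\ldots,d+k$, $C_p:=\Lambda^Te_{p+1}^T\otimes M^T$ and $S_p:=C_p+C_p^T$, where $e_{p+1}$ is the $(p+1)$th standard unit vector of $\mathbb{R}^{d+k+1}$. For $(t_0,\ldots,t_{2(d+k)})\in\mathbb{R}^{2(d+k)+1}$ define $$f(t_0,\ldots,t_{2(d+k)}):=(t_0+it_1)S_0+(t_2+it_3)S_1+\cdots+(t_{2(d+k)-2}+it_{2(d+k)-1})S_{d+k-1}+t_{2(d+k)}S_{d+k}.$$ Then $$\eta^{\mathrm{ssym}}(G,\lambda)\ \ge\ \left(\inf_{(t_0,\ldots,t_{2(d+k)})\in\mathbb{R}^{2(d+k)+1}}\lambda_2\left(\begin{bmatrix}J&\overline{f(t_0,\ldots,t_{2(d+k)})}\\ f(t_0,\ldots,t_{2(d+k)})&\overline{J}\end{bmatrix}\right)\right)^{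-\frac12}.$$
   Context: A rational matrix polynomial (RMP) is $G(z)=\sum_{p=0}^d z^pA_p+\sum_{j=1}^k w_j(z)E_j$ with $A_p,E_j\in\mathbb{C}^{n\times n}$ and $w_j(z)=s_j(z)/q_j(z)$, where $s_j,q_j$ are scalar polynomials, $q_j\not\equiv0$. The poles of $G(z)$ are the roots of the $q_j$. $\|\cdot\|$ is the spectral norm (Euclidean norm for vectors). For a tuple of $n\times n$ matrices, the tuple norm is $$|||(\Delta A_0,\ldots,\Delta A_d,\Delta E_1,\ldots,\Delta E_k)|||:=\sqrt{\textstyle\sum_{p=0}^d\|\Delta A_p\|^2+\sum_{j=1}^k\|\Delta E_j\|^2}.$$ For $\mathbb{S}\subseteq(\mathbb{C}^{n\times n})^{d+k+1}$ the structured eigenvalue backward error $\eta^{\mathbb{S}}(G,\lambda)$ is the infimum of $|||(\Delta A_0,\ldots,\Delta E_k)|||$ over all $(\Delta A_0,\ldots,\Delta A_d,\Delta E_1,\ldots,\Delta E_k)\in\mathbb{S}$ with $$\det\Big(\sum_{p=0}^d\lambda^p(A_p-\Delta A_p)+\sum_{j=1}^kw_j(\lambda)(E_j-\Delta E_j)\Big)=0.$$ $\eta^{\mathrm{ssym}}(G,\lambda)$ denotes $\eta^{\mathbb{S}}(G,\lambda)$ when $\mathbb{S}$ is the set of tuples of skew-symmetric ($X^T=-X$) complex $n\times n$ matrices. $\lambda_2(H)$ is the second largest eigenvalue (counted with multiplicity) of a Hermitian matrix $H$; $\overline{X}$ is the entrywise complex conjugate; $\otimes$ is the Kronecker product. 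*)

(* Defs.v *)
From HB Require Import structures.
From mathcomp Require Import all_boot all_order all_algebra.
From mathcomp Require Import all_classical all_reals ereal.
From mathcomp Require Import complex mxtens.

Set Implicit Arguments.
Unset Strict Implicit.
Unset Printing Implicit Defensive.

Import Order.TTheory GRing.Theory Num.Theory.
Local Open Scope ring_scope.
Local Open Scope classical_set_scope.
Local Open Scope complex_scope.
Local Open Scope sesquilinear_scope.

Section MatrixNotions.
Variable R : realType.
Implicit Types m n : nat.

Definition vnorm n (x : 'cV[R[i]]_n) : R :=
  Num.sqrt (\sum_(i < n) Normc.normc (x i ord0) ^+ 2).

Definition spectral_norm m n (A : 'M[R[i]]_(m, n)) : R :=
  sup [set vnorm (A *m x) | x in [set x : 'cV[R[i]]_n | vnorm x = 1]].

Definition skew_symmetric n (X : 'M[R[i]]_n) : Prop := X^T = - X.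

Definition conjmx m n (X : 'M[R[i]]_(m, n)) : 'M[R[i]]_(m, n) :=
  map_mx Num.conj X.

(* The roots of the characteristic polynomial, with multiplicity. *)
Definition eigenvalues n (H : 'M[R[i]]_n) : seq R[i] :=
  sval (closed_field_poly_normal (char_poly H)).

(* Only meaningful for a Hermitian [H] of size at least 2: its eigenvalues are
   then real, so that taking real parts loses nothing. *)
Definition lambda2 n (H : 'M[R[i]]_n) : R :=
  nth 0 (sort (fun x y : R => y <= x) [seq complex.Re z | z <- eigenvalues H])
    1.

End MatrixNotions.

Section RationalMatrixPolynomials.
Variables (R : realType) (n d k : nat).
Local Notation C := R[i].

Record mxtuple := MxTuple {
  tupA : 'I_d.+1 -> 'M[C]_n;
  tupE : 'I_k -> 'M[C]_n }.

Definition tuple_norm (D : mxtuple) : R :=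
  Num.sqrt (\sum_(p < d.+1) spectral_norm (tupA D p) ^+ 2
            + \sum_(j < k) spectral_norm (tupE D j) ^+ 2).

Definition mxtuple_sub (T D : mxtuple) : mxtuple :=
  MxTuple (fun p => tupA T p - tupA D p) (fun j => tupE T j - tupE D j).

Definition skew_tuples : set mxtuple :=
  [set D | (forall p, skew_symmetric (tupA D p)) /\
           (forall j, skew_symmetric (tupE D j))].

Record rmp := Rmp {
  coefs : mxtuple;
  wnum : 'I_k -> {poly C};
  wden : 'I_k -> {poly C};
  wden_neq0 : forall j, wden j != 0 }.

(* Meaningful away from the roots of [wden G j], since division is total. *)
Definition weight (G : rmp) (j : 'I_k) (z : C) : C :=
  (wnum G j).[z] / (wden G j).[z].

Definition is_pole (G : rmp) (z : C) : Prop := exists j, root (wden G j) z.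

(* The value at [z] of the RMP with the weights of [G] and coefficients [T]. *)
Definition eval_with (G : rmp) (T : mxtuple) (z : C) : 'M[C]_n :=
  \sum_(p < d.+1) z ^+ p *: tupA T p + \sum_(j < k) weight G j z *: tupE T j.

Definition eval_rmp (G : rmp) (z : C) : 'M[C]_n := eval_with G (coefs G) z.

Definition backward_error (S : set mxtuple) (G : rmp) (z : C) : \bar R :=
  ereal_inf [set (tuple_norm D)%:E | D in
    [set D | S D /\ \det (eval_with G (mxtuple_sub (coefs G) D) z) = 0]].

Definition Lambda_row (G : rmp) (z : C) : 'rV[C]_(d + k).+1 :=
  row_mx (\row_(p < d.+1) z ^+ p) (\row_(j < k) weight G j z).

End RationalMatrixPolynomials.

Section BoundMatrices.
Variables (R : realType) (n m : nat).
Local Notation C := R[i].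
Variables (L : 'rV[C]_m.+1) (M : 'M[C]_n).

Definition Jmx : 'M[C]_(m.+1 * n) := (L^t* *m L) *t (M^t* *m M).

Definition Cmx (p : 'I_m.+1) : 'M[C]_(m.+1 * n) :=
  (L^T *m delta_mx (ord0 : 'I_1) p) *t M^T.

Definition Smx (p : 'I_m.+1) : 'M[C]_(m.+1 * n) := Cmx p + (Cmx p)^T.

Definition fmx (t : 'rV[R]_(2 * m).+1) : 'M[C]_(m.+1 * n) :=
  \sum_(p < m) (t ord0 (inord (2 * p)) +i* t ord0 (inord (2 * p).+1)) *:
                 Smx (widen_ord (leqnSn m) p)
  + (t ord0 (inord (2 * m)))%:C *: Smx ord_max.

Definition Hmx (t : 'rV[R]_(2 * m).+1) : 'M[C]_(m.+1 * n + m.+1 * n) :=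
  block_mx Jmx (conjmx (fmx t)) (fmx t) (conjmx Jmx).

End BoundMatrices.

(* Main.v *)
Require Import Defs.
From HB Require Import structures.
From mathcomp Require Import all_boot all_order all_algebra.
From mathcomp Require Import all_classical all_reals ereal.
From mathcomp Require Import complex mxtens.

Set Implicit Arguments.
Unset Strict Implicit.
Unset Printing Implicit Defensive.

Import Order.TTheory GRing.Theory Num.Theory.
Local Open Scope ring_scope.
Local Open Scope classical_set_scope.
Local Open Scope complex_scope.
Local Open Scope sesquilinear_scope.

(** A skew-symmetric perturbation that makes the matrix at [lambda] singular
    yields a vector [v] whose Rayleigh quotient for [J] is at least the inverse
    square of the size of the perturbation, and which is isotropic for every
    [S_p]; such a quotient is a lower bound for [lambda2] of every [Hmx].

    Write [X_p] for the matrices of the perturbation, [L_p] for the entries of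
    [Lambda] and [D] for the sum of the [L_p X_p], and let [x != 0] be killed by
    [G(lambda) - D].  With [v_p := X_p x] one gets [G(lambda) x = D x], that is
    [x = M (sum_p L_p v_p)], and skew-symmetry gives [x^T v_p = 0] for all [p].
    As [|v_p| <= ||X_p|| |x|], the sum of the [|v_p|^2] is at most
    [|||X|||^2 |x|^2].  This is [backward_error_witness].

    Stack the [v_p] into one vector [v], and let [W] be the block row with
    blocks [L_p M].  Then [W v = x], [J = W^* W] and [C_p v = W^T v_p], so that
    [v^* J v = |x|^2] and [v^T S_p v = 2 x^T v_p = 0].  Consequently
    [v^T f(t) v = 0] for every [t], and on the plane spanned by [(v, 0)] and
    [(0, conj v)] the Hermitian form of [Hmx] is [|x|^2 / |v|^2] times the squared
    norm.  The Courant-Fischer principle ([lambda2_ge]) turns the existence of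
    such a plane into [|x|^2 / |v|^2 <= lambda2 (Hmx t)], which is
    [quotient_le_lambda2].  Both bounds together give
    [|||X|||^-2 <= lambda2 (Hmx t)] for every [t], and the theorem
    follows by taking the infimum, square roots and inverses. *)

(** * Euclidean and spectral norms *)

Lemma sqr_normcC (R : realType) (z : R[i]) :
  (Normc.normc z ^+ 2)%:C = Num.conj z * z.
Proof.
by rewrite mulrC -normCK normc_def -rmorphXn; case: z.
Qed.

Lemma normc_ge0 (R : realType) (z : R[i]) : 0 <= Normc.normc z.
Proof. by case: z => a b; exact: sqrtr_ge0. Qed.

Lemma sqr_vnorm (R : realType) n (x : 'cV[R[i]]_n) :
  vnorm x ^+ 2 = \sum_(i < n) Normc.normc (x i ord0) ^+ 2.
Proof. by rewrite sqr_sqrtr// sumr_ge0// => i _; exact: sqr_ge0. Qed.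

Lemma sqr_vnormC (R : realType) n (x : 'cV[R[i]]_n) :
  (vnorm x ^+ 2)%:C = (x^t* *m x) ord0 ord0.
Proof.
rewrite sqr_vnorm rmorph_sum mxE /=; apply: eq_bigr => i _.
by rewrite sqr_normcC !mxE.
Qed.

Lemma vnorm_ge0 (R : realType) n (x : 'cV[R[i]]_n) : 0 <= vnorm x.
Proof. exact: sqrtr_ge0. Qed.

Lemma vnorm_eq0 (R : realType) n (x : 'cV[R[i]]_n) : (vnorm x == 0) = (x == 0).
Proof.
rewrite -sqrf_eq0 sqr_vnorm psumr_eq0; last by move=> i _; exact: sqr_ge0.
apply/allP/eqP => [x0|-> i _].
  apply/matrixP => i j; rewrite ord1 mxE; apply: Normc.eq0_normc.
  by apply/eqP; rewrite -sqrf_eq0; apply: x0; rewrite mem_index_enum.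
by rewrite mxE Normc.normc0 expr0n /= eqxx.
Qed.

Lemma vnorm0 (R : realType) n : vnorm (0 : 'cV[R[i]]_n) = 0.
Proof. by apply/eqP; rewrite vnorm_eq0. Qed.

Lemma vnorm_gt0 (R : realType) n (x : 'cV[R[i]]_n) : (0 < vnorm x) = (x != 0).
Proof. by rewrite lt_def vnorm_ge0 andbT vnorm_eq0. Qed.

Lemma vnormZ (R : realType) n (a : R[i]) (x : 'cV[R[i]]_n) :
  vnorm (a *: x) = Normc.normc a * vnorm x.
Proof.
apply/eqP; rewrite -(@eqrXn2 _ 2) ?vnorm_ge0 ?mulr_ge0 ?normc_ge0 ?vnorm_ge0//.
rewrite exprMn !sqr_vnorm mulr_sumr; apply/eqP; apply: eq_bigr => i _.
by rewrite mxE Normc.normcM exprMn.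
Qed.

Lemma normc_sum_le (R : realType) n (F : 'I_n -> R[i]) :
  Normc.normc (\sum_i F i) <= \sum_i Normc.normc (F i).
Proof.
elim/big_ind2: _ => [|a b c e ab ce|i _] //; first by rewrite Normc.normc0.
exact: le_trans (le_normcD _ _) (lerD ab ce).
Qed.

(** [sup] is only an upper bound for a bounded set.  The bound used here is the
    crude one: the coordinates of a unit vector have modulus at most 1, so those
    of [A *m x] are bounded by the absolute row sums of [A]. *)
Lemma spectral_norm_bounded (R : realType) m n (A : 'M[R[i]]_(m, n)) :
  has_ubound [set vnorm (A *m x) | x in [set x : 'cV[R[i]]_n | vnorm x = 1]].
Proof.
exists (Num.sqrt (\sum_i (\sum_j Normc.normc (A i j)) ^+ 2)) => _ [x /= x1 <-].
apply: ler_wsqrtr; apply: ler_sum => i _.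
have xj1 j : Normc.normc (x j ord0) <= 1.
  rewrite -(@expr_le1 _ 2) ?normc_ge0//.
  rewrite -(expr1n _ 2) -[in leRHS]x1 sqr_vnorm (bigD1 j)//= lerDl.
  by rewrite sumr_ge0// => l _; exact: sqr_ge0.
rewrite lerXn2r ?nnegrE ?normc_ge0 ?sumr_ge0// => [j _|]; first exact: normc_ge0.
rewrite mxE (le_trans (normc_sum_le _))//; apply: ler_sum => j _.
by rewrite Normc.normcM ler_piMr// normc_ge0.
Qed.

Lemma vnorm_mul_le (R : realType) m n (A : 'M[R[i]]_(m, n)) (x : 'cV[R[i]]_n) :
  vnorm (A *m x) <= spectral_norm A * vnorm x.
Proof.
have [->|x0] := eqVneq x 0.
  by rewrite mulmx0 !vnorm0 mulr0.
have nx0 : 0 < vnorm x by rewrite vnorm_gt0.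
have nc : Normc.normc ((vnorm x)^-1%:C) = (vnorm x)^-1.
  by rewrite /= expr0n /= addr0 sqrtr_sqr ger0_norm// invr_ge0 ltW.
rewrite -ler_pdivrMr// mulrC -{1}nc -vnormZ scalemxAr.
apply: ub_le_sup; first exact: spectral_norm_bounded.
exists ((vnorm x)^-1%:C *: x) => //=.
by rewrite vnormZ nc mulVf// gt_eqF.
Qed.

(** * The second eigenvalue of a Hermitian matrix *)

(** [eigenvalues] lists the roots of the characteristic polynomial, which unitary
    diagonalization does not change; both lists are then the roots of the same
    product of linear factors. *)
Lemma eigenvalues_normal (R : realType) n (H : 'M[R[i]]_n) :
  H \is normalmx ->
  perm_eq (eigenvalues H) [seq spectral_diag H ord0 i | i <- enum 'I_n].
Proof.
move=> /orthomx_spectralP Hd.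
apply: prod_XsubC_eq.
rewrite big_map big_enum /eigenvalues.
case: closed_field_poly_normal => r /= rE.
move: rE; rewrite (monicP (char_poly_monic H)) scale1r => <-.
have Pu := spectral_unit H.
rewrite [in LHS]Hd; set P := spectralmx H in Hd Pu *.
set D := diag_mx _.
have -> : char_poly (invmx P *m D *m P) = char_poly D.
  have PP : map_mx polyC (invmx P) *m map_mx polyC P = 1%:M.
    by rewrite -map_mxM mulVmx// map_mx1.
  rewrite /char_poly /char_poly_mx.
  have -> : 'X%:M - map_mx polyC (invmx P *m D *m P) =
     map_mx polyC (invmx P) *m ('X%:M - map_mx polyC D) *m map_mx polyC P.
    rewrite mulmxBr mulmxBl !map_mxM; congr (_ - _).
    by rewrite -mulmxA -scalar_mxC mulmxA PP mul1mx.
  by rewrite !det_mulmx mulrAC -det_mulmx PP det1 mul1r.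
rewrite char_poly_trig; last exact: (diag_mx_is_trig _).
by apply: eq_bigr => i _; rewrite mxE eqxx mulr1n.
Qed.

(** Since [nth] has the default value 0, a list with fewer than two elements may
    also satisfy the hypothesis; the conclusion holds there for lack of
    elements. *)
Lemma count_ge_of_nth1_lt (R : realType) (s : R) (r : seq R) :
  nth 0 (sort (fun x y : R => y <= x) r) 1 < s ->
  (count (fun x => s <= x)%R r <= 1)%N.
Proof.
have : sorted (fun x y : R => y <= x) (sort (fun x y : R => y <= x) r).
  by apply: sort_sorted => x y; exact: le_total.
rewrite -(permP (permEl (perm_sort (fun x y : R => y <= x) r))).
case: (sort _ r) => [|a [|b l]] //=.
  by rewrite addn0 leq_b1.
move=> /andP[_ bl] bs; rewrite leNgt [s <= b]leNgt bs /= add0n.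
have /eqP -> : count (fun x => s <= x) l == 0%N.
  rewrite -leqn0 leqNgt -has_count; apply/hasPn => x xl /=.
  rewrite -ltNge; apply: le_lt_trans bs.
  have tr : transitive (fun x y : R => y <= x).
    by move=> y u v /[swap]; exact: le_trans.
  by move: (order_path_min tr bl) => /allP /(_ x xl).
by rewrite addn0 leq_b1.
Qed.

Lemma quad_spectral (R : realType) n (H : 'M[R[i]]_n) (u : 'cV[R[i]]_n) :
  H \is hermsymmx ->
  (u^t* *m H *m u) ord0 ord0 =
  (\sum_i complex.Re (spectral_diag H ord0 i)
         * Normc.normc ((spectralmx H *m u) i ord0) ^+ 2)%:C.
Proof.
move=> Hh; have /orthomx_spectralP Hd := hermitian_normalmx Hh.
have PU := spectral_unitarymx H.
have dreal i : (complex.Re (spectral_diag H ord0 i))%:C = spectral_diag H ord0 i.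
  by apply: RRe_real; exact: (mxOverP (hermitian_spectral_diag_real Hh)).
rewrite {1}Hd invmx_unitary//.
set P := spectralmx H.
have -> : u^t* *m (P^t* *m diag_mx (spectral_diag H) *m P) *m u =
   (P *m u)^t* *m diag_mx (spectral_diag H) *m (P *m u).
  by rewrite trmx_mul map_mxM !mulmxA.
move: (P *m u) => c; rewrite mul_mx_diag mxE rmorph_sum /=.
apply: eq_bigr => i _; rewrite rmorphM /= sqr_normcC dreal !mxE.
by rewrite mulrAC mulrC.
Qed.

Lemma unitary_vnorm (R : realType) n (P : 'M[R[i]]_n) (u : 'cV[R[i]]_n) :
  P \is unitarymx -> vnorm (P *m u) ^+ 2 = vnorm u ^+ 2.
Proof.
move=> PU; apply: (fmorph_inj (real_complex R)) => /=.
rewrite !sqr_vnormC trmx_mul map_mxM mulmxA -(mulmxA _ (P^t*)).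
by rewrite -invmx_unitary// mulVmx ?mulmx1// unitarymx_unit.
Qed.

(** One half of the Courant-Fischer principle.  If the second eigenvalue were
    below [s], at most one eigenvalue would reach [s].  The plane spanned by
    [u1] and [u2] contains a nonzero vector without component along the
    corresponding eigenvector, and there the form is smaller than [s] times the
    squared norm. *)
Lemma lambda2_ge (R : realType) n (H : 'M[R[i]]_n) (s : R)
    (u1 u2 : 'cV[R[i]]_n) :
  H \is hermsymmx ->
  (forall a b, a *: u1 + b *: u2 = 0 -> a = 0 /\ b = 0) ->
  (forall a b, let u := a *: u1 + b *: u2 in
     (s * vnorm u ^+ 2)%:C <= (u^t* *m H *m u) ord0 ord0) ->
  s <= lambda2 H.
Proof.
move=> Hh free Hs; rewrite leNgt; apply/negP => /count_ge_of_nth1_lt.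
pose d i := complex.Re (spectral_diag H ord0 i).
have /permP cE := perm_map (@complex.Re R)
  (eigenvalues_normal (hermitian_normalmx Hh)).
rewrite cE -map_comp count_map => cle1.
have /card_le1_eqP dle1 : (#|[pred i | (s <= d i)%R]| <= 1)%N.
  by rewrite cardE size_filter; move: cle1; rewrite enumT.
(* [F] is the coordinate along the eigenvector of the eigenvalue that reaches
   [s], or the zero functional when no eigenvalue does. *)
have [F [Flin F0]] : exists F : 'cV[R[i]]_n -> R[i],
    (forall a b x y, F (a *: x + b *: y) = a * F x + b * F y) /\
    (forall u i, F u = 0 -> s <= d i -> (spectralmx H *m u) i ord0 = 0).
  have [i0 si0|sd] := pickP [pred i | s <= d i].
    exists (fun u => (spectralmx H *m u) i0 ord0); split => [a b x y|u j Fu sj].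
      by rewrite mulmxDr -!scalemxAr !mxE.
    by rewrite (dle1 i0 j).
  exists (fun _ => 0); split=> [a b _ _|u i _ si]; first by rewrite !mulr0 addr0.
  by have := sd i; rewrite /= si.
have [[a b] [ab0 Fab]] : exists ab : R[i] * R[i], ~ (ab.1 = 0 /\ ab.2 = 0) /\
    F (ab.1 *: u1 + ab.2 *: u2) = 0.
  have [e|e] := eqVneq (F u1) 0.
    exists (1, 0); split => [[/eqP]|]; first by rewrite oner_eq0.
    by rewrite Flin e mulr0 mul0r addr0.
  exists (F u2, - F u1); split=> [[_ /eqP]|]; first by rewrite oppr_eq0 (negPf e).
  by rewrite Flin mulNr mulrC subrr.
set u := _ + _ in Fab.
have u0 : u != 0 by apply/eqP => /free.
have := Hs a b; rewrite -/u /= quad_spectral// lecR.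
rewrite -(unitary_vnorm u (spectral_unitarymx H)).
set c := spectralmx H *m u.
have c0 : c != 0.
  apply: contra u0 => /eqP c0.
  by rewrite -(mulKmx (spectral_unit H) u) -/c c0 mulmx0.
apply/negP; rewrite -ltNge sqr_vnorm mulr_sumr.
have termle i :
    d i * Normc.normc (c i ord0) ^+ 2 <= s * Normc.normc (c i ord0) ^+ 2.
  have [sd|ds] := leP s (d i); last by rewrite ler_wpM2r ?sqr_ge0 ?ltW.
  by rewrite /c F0// Normc.normc0 expr0n !mulr0.
have [i ci] : exists i, c i ord0 != 0.
  apply/existsP; apply: contraR c0 => /existsPn nc; apply/eqP/matrixP => i j.
  by rewrite ord1 [RHS]mxE; apply/eqP; have := nc i; rewrite negbK.
rewrite (bigD1 i)//= [ltRHS](bigD1 i)//=.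
apply: ltr_leD; last by apply: ler_sum => j _; exact: termle.
rewrite ltr_pM2r.
  by rewrite ltNge; apply/negP => sd; move: ci; rewrite /c F0// eqxx.
rewrite exprn_gt0// lt_def normc_ge0 andbT; apply: contra ci => /eqP h.
by rewrite (Normc.eq0_normc h).
Qed.

(** * Stacked vectors and the Kronecker products *)

(** [stack vs] is the sum of the [e_p *t vs p], a column of blocks [vs p]. *)
Definition stack (R : realType) (m n : nat) (vs : 'I_m -> 'cV[R[i]]_n) :
    'cV[R[i]]_(m * n) :=
  \col_k vs (mxtens_unindex k).1 (mxtens_unindex k).2 ord0.

(** This is [L *t M], with [n] rows instead of [1 * n]. *)
Definition block_row (R : realType) (m n : nat) (L : 'rV[R[i]]_m)
    (M : 'M[R[i]]_n) : 'M[R[i]]_(n, m * n) :=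
  \matrix_(i, k) (L ord0 (mxtens_unindex k).1 * M i (mxtens_unindex k).2).

Lemma big_mxtens (V : nmodType) (m n : nat) (F : 'I_m -> 'I_n -> V) :
  \sum_(k < m * n) F (mxtens_unindex k).1 (mxtens_unindex k).2 =
  \sum_(p < m) \sum_(i < n) F p i.
Proof.
rewrite pair_bigA (reindex (@mxtens_index m n)).
  by apply: eq_bigr => -[p i] _; rewrite mxtens_indexK.
exists (@mxtens_unindex m n) => k _; first exact: mxtens_indexK.
exact: mxtens_unindexK.
Qed.

Lemma sqr_vnorm_stack (R : realType) m n (vs : 'I_m -> 'cV[R[i]]_n) :
  vnorm (stack vs) ^+ 2 = \sum_p vnorm (vs p) ^+ 2.
Proof.
rewrite sqr_vnorm (eq_bigr (fun k => Normc.normc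
  (vs (mxtens_unindex k).1 (mxtens_unindex k).2 ord0) ^+ 2)); last first.
  by move=> k _; rewrite mxE.
rewrite (big_mxtens (fun p i => Normc.normc (vs p i ord0) ^+ 2)).
by apply: eq_bigr => p _; rewrite sqr_vnorm.
Qed.

Lemma block_row_stack (R : realType) m n (L : 'rV[R[i]]_m) (M : 'M[R[i]]_n)
    (vs : 'I_m -> 'cV[R[i]]_n) :
  block_row L M *m stack vs = M *m \sum_p L ord0 p *: vs p.
Proof.
apply/colP => i; rewrite mxE.
under eq_bigr do rewrite !mxE.
rewrite (big_mxtens (fun p j => L ord0 p * M i j * vs p j ord0)).
rewrite mulmx_sumr summxE; apply: eq_bigr => p _.
rewrite -scalemxAr !mxE mulr_sumr; apply: eq_bigr => j _.
by rewrite mulrA.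
Qed.

Lemma JmxE (R : realType) n m (L : 'rV[R[i]]_m.+1) (M : 'M[R[i]]_n) :
  Jmx L M = (block_row L M)^t* *m block_row L M.
Proof.
apply/matrixP => k l; rewrite !mxE big_ord1 !mxE mulr_sumr.
apply: eq_bigr => i _; rewrite !mxE rmorphM /=.
by rewrite mulrACA.
Qed.

(** [C_p] factors through the [p]-th block: it is [W^T] times the projection onto
    that block, where [W] is the block row. *)
Lemma Cmx_stack (R : realType) n m (L : 'rV[R[i]]_m.+1) (M : 'M[R[i]]_n)
    (p : 'I_m.+1) (vs : 'I_m.+1 -> 'cV[R[i]]_n) :
  Cmx L M p *m stack vs = (block_row L M)^T *m vs p.
Proof.
apply/colP => k; rewrite !mxE.
under eq_bigr do rewrite !mxE big_ord1 !mxE.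
rewrite (big_mxtens (fun q j => L ord0 (mxtens_unindex k).1 *
  ((ord0 == ord0 :> 'I_1) && (q == p))%:R * M j (mxtens_unindex k).2 *
  vs q j ord0)).
rewrite (bigD1 p)//= [X in _ + X]big1 ?addr0 => [|q /negPf qp]; last first.
  by rewrite big1// => j _; rewrite qp mulr0 !mul0r.
by apply: eq_bigr => j _; rewrite eqxx mulr1 !mxE.
Qed.

Lemma trmx_1x1 (R : realType) (A : 'M[R[i]]_1) : A^T = A.
Proof. by apply/matrixP => i j; rewrite mxE !ord1. Qed.

(** [C_p] and its transpose define the same quadratic form, equal to [x^T v_p]
    at the stacked vector, with [x] its image under the block row. *)
Lemma fmx_stack (R : realType) n m (L : 'rV[R[i]]_m.+1) (M : 'M[R[i]]_n)
    (vs : 'I_m.+1 -> 'cV[R[i]]_n) (t : 'rV[R]_(2 * m).+1) :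
  (forall p, (block_row L M *m stack vs)^T *m vs p = 0) ->
  (stack vs)^T *m fmx L M t *m stack vs = 0.
Proof.
set v := stack vs => orth.
have C0 p : v^T *m Cmx L M p *m v = 0.
  by rewrite -mulmxA Cmx_stack mulmxA -trmx_mul orth.
have S0 p : v^T *m Smx L M p *m v = 0.
  rewrite mulmxDr mulmxDl C0 add0r -[v^T *m _ *m v]trmx_1x1.
  by rewrite !trmx_mul !trmxK mulmxA C0.
rewrite /fmx mulmxDr mulmxDl -scalemxAr -scalemxAl S0 scaler0 addr0.
rewrite mulmx_sumr mulmx_suml big1// => p _.
by rewrite -scalemxAr -scalemxAl S0 scaler0.
Qed.

(** * The second eigenvalue of the block matrix *)

Lemma fmx_sym (R : realType) n m (L : 'rV[R[i]]_m.+1) (M : 'M[R[i]]_n)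
    (t : 'rV[R]_(2 * m).+1) : (fmx L M t)^T = fmx L M t.
Proof.
have Ssym p : (Smx L M p)^T = Smx L M p by rewrite linearD /= trmxK addrC.
rewrite linearD linearZ /= Ssym linear_sum; congr (_ + _).
by apply: eq_bigr => p _; rewrite linearZ /= Ssym.
Qed.

Lemma Hmx_herm (R : realType) n m (L : 'rV[R[i]]_m.+1) (M : 'M[R[i]]_n)
    (t : 'rV[R]_(2 * m).+1) : Hmx L M t \is hermsymmx.
Proof.
have Jherm : (Jmx L M)^t* = Jmx L M.
  by rewrite JmxE trmx_mul map_mxM trmxCK.
apply/is_hermitianmxP; rewrite expr0 scale1r /Hmx tr_block_mx map_block_mx.
rewrite Jherm /Defs.conjmx !map_trmx fmx_sym Jherm; congr (block_mx _ _ _ _).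
by apply/matrixP => i j; rewrite !mxE conjCK.
Qed.

(** The diagonal blocks contribute [|W v|^2] each, [W] being the block row; the
    off-diagonal ones contribute [v^T f v] and its conjugate, hence nothing. *)
Lemma Hmx_plane (R : realType) n m (L : 'rV[R[i]]_m.+1) (M : 'M[R[i]]_n)
    (t : 'rV[R]_(2 * m).+1) (v : 'cV[R[i]]_(m.+1 * n)) (a b : R[i]) :
  v^T *m fmx L M t *m v = 0 ->
  let u := a *: col_mx v 0 + b *: col_mx 0 (Defs.conjmx v) in
  (u^t* *m Hmx L M t *m u) ord0 ord0 =
  ((Normc.normc a ^+ 2 + Normc.normc b ^+ 2)
    * vnorm (block_row L M *m v) ^+ 2)%:C.
Proof.
move=> vfv /=.
have vJv : v^t* *m Jmx L M *m v = (vnorm (block_row L M *m v) ^+ 2)%:C%:M.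
  rewrite [LHS]mx11_scalar sqr_vnormC JmxE; congr (_ _ _)%:M.
  by rewrite trmx_mul map_mxM !mulmxA.
have cJc : (Defs.conjmx v)^t* *m Defs.conjmx (Jmx L M) *m Defs.conjmx v =
    (vnorm (block_row L M *m v) ^+ 2)%:C%:M.
  rewrite map_trmx -!map_mxM vJv map_scalar_mx /=.
  by congr _%:M; exact: conjc_real.
have cfc : v^t* *m Defs.conjmx (fmx L M t) *m Defs.conjmx v = 0.
  by rewrite -!map_mxM vfv map_mx0.
have vfv' : (Defs.conjmx v)^t* *m fmx L M t *m v = 0.
  rewrite (_ : (Defs.conjmx v)^t* = v^T)//.
  by apply/matrixP => i j; rewrite !mxE conjCK.
rewrite !scale_col_mx !scaler0 add_col_mx add0r addr0 tr_col_mx map_row_mx.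
rewrite mul_row_block mul_row_col !linearZ /= !map_mxZ.
rewrite !mulmxDl -!scalemxAl vJv cJc cfc vfv' !scaler0 addr0 add0r.
rewrite !mxE eqxx !mulr1n [RHS]rmorphM [in RHS]rmorphD /= !sqr_normcC.
by rewrite mulrDl [_ * a]mulrC [_ * b]mulrC -!mulrA.
Qed.

Lemma vnorm_plane (R : realType) n (v : 'cV[R[i]]_n) (a b : R[i]) :
  vnorm (a *: col_mx v 0 + b *: col_mx 0 (Defs.conjmx v)) ^+ 2 =
  (Normc.normc a ^+ 2 + Normc.normc b ^+ 2) * vnorm v ^+ 2.
Proof.
rewrite !scale_col_mx !scaler0 add_col_mx add0r addr0 !sqr_vnorm big_split_ord /=.
rewrite mulrDl !mulr_sumr; congr (_ + _); apply: eq_bigr => i _.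
  by rewrite col_mxEu mxE Normc.normcM exprMn.
rewrite col_mxEd !mxE Normc.normcM exprMn; congr (_ * _ ^+ 2).
by case: (v i ord0) => x y /=; rewrite sqrrN.
Qed.

(** On the plane spanned by [(v, 0)] and [(0, conj v)], for [v] the stacked vector,
    the form of [Hmx] is the quotient on the left times the squared norm. *)
Lemma quotient_le_lambda2 (R : realType) n m (L : 'rV[R[i]]_m.+1)
    (M : 'M[R[i]]_n) (vs : 'I_m.+1 -> 'cV[R[i]]_n) (t : 'rV[R]_(2 * m).+1) :
  let x := M *m \sum_p L ord0 p *: vs p in
  x != 0 -> (forall p, x^T *m vs p = 0) ->
  vnorm x ^+ 2 / \sum_p vnorm (vs p) ^+ 2 <= lambda2 (Hmx L M t).
Proof.
move=> x x0 orth; set v := stack vs.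
have Wv : block_row L M *m v = x by rewrite block_row_stack.
have v0 : v != 0 by apply: contra x0 => /eqP v0; rewrite -Wv v0 mulmx0.
have nv0 : 0 < vnorm v ^+ 2 by rewrite exprn_gt0// vnorm_gt0.
have vfv : v^T *m fmx L M t *m v = 0.
  by apply: fmx_stack => p; rewrite Wv.
apply: (@lambda2_ge _ _ _ _ (col_mx v 0) (col_mx 0 (Defs.conjmx v))).
- exact: Hmx_herm.
- move=> a b u0; have := vnorm_plane v a b.
  rewrite u0 vnorm0 expr0n /= => /esym/eqP.
  rewrite mulf_eq0 (gt_eqF nv0) orbF paddr_eq0 ?sqr_ge0// !sqrf_eq0.
  by move=> /andP[/eqP/Normc.eq0_normc -> /eqP/Normc.eq0_normc ->].
- move=> a b /=; rewrite Hmx_plane// vnorm_plane lecR Wv -sqr_vnorm_stack.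
  by rewrite mulrCA mulrAC -mulrA mulfV ?gt_eqF// mulr1 mulrA.
Qed.

(** * Singular perturbations and the bound *)

Lemma skew_quad_eq0 (R : realType) n (X : 'M[R[i]]_n) (x : 'cV[R[i]]_n) :
  skew_symmetric X -> x^T *m (X *m x) = 0.
Proof.
move=> Xs; set c := _ *m _.
have cN : c = - c.
  by rewrite -[LHS]trmx_1x1 /c !trmx_mul trmxK Xs mulmxN mulNmx mulmxA.
apply/matrixP => i j; rewrite [RHS]mxE; apply/eqP.
rewrite -eqNr; apply/eqP.
by have := congr1 (fun A : 'M_1 => A i j) cN; rewrite /= [in RHS]mxE.
Qed.

(** The vectors are [vs p = X_p x] for the matrices [X_p] of [D] and a kernel
    vector [x] of the perturbed matrix; since [G(z) x = sum_p L_p X_p x], the [x]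
    of the statement, recovered from [vs] by inverting [G(z)], is that vector. *)
Lemma backward_error_witness (R : realType) n d k (G : rmp R n d k) (z : R[i])
    (D : mxtuple R n d k) :
  skew_tuples D -> \det (eval_with G (mxtuple_sub (coefs G) D) z) = 0 ->
  eval_rmp G z \in unitmx ->
  exists vs : 'I_(d + k).+1 -> 'cV[R[i]]_n,
    let x := invmx (eval_rmp G z) *m \sum_p Lambda_row G z ord0 p *: vs p in
    [/\ x != 0, forall p, x^T *m vs p = 0
      & \sum_p vnorm (vs p) ^+ 2 <= tuple_norm D ^+ 2 * vnorm x ^+ 2].
Proof.
move=> [skA skE] /eqP detz Gu.
have [x x0 xE] : exists2 x : 'cV_n, x != 0 &
    eval_with G (mxtuple_sub (coefs G) D) z *m x = 0.
  move: detz; rewrite -det_tr => /det0P [y y0 yE].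
  exists y^T; first by rewrite trmx_eq0.
  by apply: trmx_inj; rewrite trmx_mul trmxK yE trmx0.
pose vs (p : 'I_(d.+1 + k)) : 'cV[R[i]]_n :=
  match fintype.split p with inl i => tupA D i *m x | inr j => tupE D j *m x end.
have vsl i : vs (lshift k i) = tupA D i *m x by rewrite /vs (unsplitK (inl i)).
have vsr j : vs (rshift d.+1 j) = tupE D j *m x by rewrite /vs (unsplitK (inr j)).
have Ll i : Lambda_row G z ord0 (lshift k i : 'I_(d.+1 + k)) = z ^+ i.
  by rewrite [LHS](row_mxEl (\row_p z ^+ p) (\row_j weight G j z)) mxE.
have Lr j : Lambda_row G z ord0 (rshift d.+1 j : 'I_(d.+1 + k)) = weight G j z.
  by rewrite [LHS](row_mxEr (\row_p z ^+ p) (\row_j weight G j z)) mxE.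
have Dx : \sum_p Lambda_row G z ord0 p *: vs p = eval_with G D z *m x.
  rewrite (@big_split_ord _ _ _ d.+1 k) /eval_with mulmxDl !mulmx_suml.
  congr (_ + _); apply: eq_bigr => i _.
    by rewrite vsl Ll scalemxAl.
  by rewrite vsr Lr scalemxAl.
have Gx : eval_rmp G z *m x = eval_with G D z *m x.
  apply/eqP; rewrite -subr_eq0 -mulmxBl -[X in _ == X]xE; apply/eqP.
  congr (_ *m _); rewrite /eval_rmp /eval_with /= opprD addrACA -!sumrB.
  by congr (_ + _); apply: eq_bigr => i _; rewrite scalerBr.
exists vs; rewrite /= Dx -Gx mulKmx//; split=> //.
  by move=> p; rewrite /vs; case: fintype.split => i; exact: skew_quad_eq0.
have bound A : vnorm (A *m x) ^+ 2 <= spectral_norm A ^+ 2 * vnorm x ^+ 2.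
  rewrite -exprMn lerXn2r ?nnegrE ?vnorm_ge0//; last exact: vnorm_mul_le.
  exact: le_trans (vnorm_ge0 _) (vnorm_mul_le _ _).
rewrite sqr_sqrtr; last by rewrite addr_ge0// sumr_ge0// => i _; exact: sqr_ge0.
rewrite (@big_split_ord _ _ _ d.+1 k) mulrDl !mulr_suml lerD// ler_sum// => i _.
  by rewrite vsl.
by rewrite vsr.
Qed.

(* With [sqrte] and [^-1] on [\bar R], a zero or negative infimum would make
   the bound [+oo]. *)
Theorem theorem3p1 (R : realType) (n d k : nat)
    (G : rmp R n d k) (lambda : R[i])
    (skewG : skew_tuples (coefs G))
    (lambda_not_pole : ~ is_pole G lambda)
    (weight_neq0 : forall j : 'I_k, weight G j lambda != 0)
    (invertible : eval_rmp G lambda \in unitmx) :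
  let M := invmx (eval_rmp G lambda) in
  let Lambda := Lambda_row G lambda in
  ((sqrte (ereal_inf
      [set (lambda2 (Hmx Lambda M t))%:E
        | t in [set: 'rV[R]_(2 * (d + k)).+1]]))^-1
   <= backward_error (@skew_tuples R n d k) G lambda)%E.
Proof.
lazy zeta; apply: le_ereal_inf_tmp => _ [D [skD detD] <-].
have [vs /= [x0 orth bnd]] := backward_error_witness skD detD invertible.
set x := _ *m _ in x0 orth bnd.
set S := \sum_p _ in bnd.
set mu := ereal_inf _.
have S0 : 0 < S.
  rewrite lt_def sumr_ge0 ?andbT => [|p _]; last exact: sqr_ge0.
  rewrite /S psumr_eq0; last by move=> p _; exact: sqr_ge0.
  apply: contra x0 => /allP vs0; rewrite /x big1 ?mulmx0// => p _.
  have := vs0 p; rewrite mem_index_enum sqrf_eq0 vnorm_eq0 => /(_ isT)/eqP ->.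
  by rewrite scaler0.
have tn0 : 0 < tuple_norm D.
  rewrite lt_def sqrtr_ge0 andbT; apply/eqP => h.
  by move: bnd; rewrite h expr0n mul0r leNgt S0.
(* The infimum is therefore positive.  The inverse of extended reals reverses the
   order between nonnegative elements only. *)
have infge : (((tuple_norm D)^-1 ^+ 2)%:E <= mu)%E.
  apply: le_ereal_inf_tmp => _ [t _ <-]; rewrite lee_fin.
  apply: le_trans (quotient_le_lambda2 t x0 orth).
  by rewrite ler_pdivlMr// exprVn mulrC ler_pdivrMr ?exprn_gt0// mulrC.
have -> : (tuple_norm D)%:E = (((tuple_norm D)^-1%:E)^-1)%E.
  by rewrite inver invr_eq0 gt_eqF// invrK.
have -> : (tuple_norm D)^-1%:E = sqrte ((tuple_norm D)^-1 ^+ 2)%:E.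
  by rewrite /= sqrtr_sqr ger0_norm// invr_ge0 ltW.
rewrite lee_pV2 ?inE ?sqrte_ge0//.
by rewrite lee_sqrt// (le_trans _ infge)// lee_fin sqr_ge0.
Qed.
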